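(* Let $\lambda$ be an infinite cardinal with $2^{2^\lambda} > (2^\lambda)^+$. Then there is a Urysohn space $X$ such that $\big((2^\lambda)^+,\lambda\big)$ is a dominating pair for $X$ but $d(X) > \lambda$.
   Context: For cardinals $\kappa > \lambda \ge \omega$, $(\kappa,\lambda)$ is a dominating pair for a topological space $X$ if for every $A \subset X$ with $|A| \le \kappa$ there is $B \subset X$ with $|B| \le \lambda$ such that $A \subset \overline{B}$. A space is Urysohn if any two distinct points have neighborhoods with disjoint closures. $d(X)$ is the density of $X$. *)

(* Defs.v *)
From mathcomp Require Import all_boot.
From mathcomp Require Import boolp classical_sets functions cardinality.
From mathcomp Require Import topology.

Set Implicit Arguments.
Unset Strict Implicit.
Unset Printing Implicit Defensive.

Local Open Scope classical_set_scope.
Local Open Scope card_scope.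

(* A cardinal is represented by a set of that cardinality, and is only ever
   used through the relations [#<=] and [card_lt]; the cardinal 2^|T| is
   represented by [set: set T]. *)
Definition card_lt T U (A : set T) (B : set U) : bool :=
  (A #<= B) && ~~ (B #<= A).
Notation "A '#<' B" := (card_lt A B)
  (at level 79, format "A  '#<'  B") : card_scope.

(* A member of least cardinality of the family F (set0 if F is empty). *)
Definition min_card T (F : set (set T)) : set T :=
  xget set0 [set A | F A /\ forall B, F B -> A #<= B].

(* The successor cardinal of |A|, realized inside the power set of T, which is
   large enough by Cantor's theorem. *)
Definition succ_card T (A : set T) : set (set T) :=
  min_card [set B : set (set T) | A #< B].

Definition density (X : topologicalType) : set X :=
  min_card [set D : set X | dense D].
Arguments density X : clear implicits.

Definition urysohn_space (X : topologicalType) : Prop :=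
  forall x y : X, x != y ->
    exists U V : set X,
      [/\ nbhs x U, nbhs y V & closure U `&` closure V = set0].

Definition dominating_pair K L (kappa : set K) (lambda : set L)
    (X : topologicalType) : Prop :=
  [/\ infinite_set lambda, lambda #< kappa &
      forall A : set X, A #<= kappa ->
        exists B : set X, B #<= lambda /\ A `<=` closure B].

Lemma ex_min_card T (F : set (set T)) :
  F !=set0 -> exists2 A, F A & forall B, F B -> A #<= B.
Proof.
move=> [A0 FA0].
have [[A FA A0']|nF] := pselect (exists2 A, F A & A = set0).
  by exists A => // B _; rewrite A0' card_ge0.
have neF A : F A -> A !=set0.
  by move=> FA; apply/set0P/eqP => AE; apply: nF; exists A.
pose P (S : set (set T -> T)) :=
  (forall f A, S f -> F A -> A (f A)) /\
  (forall f g A, S f -> S g -> F A -> f A = g A -> f = g).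
have [S [[S1 S2] Smax]] : exists S, P S /\ forall S', S `<` S' -> ~ P S'.
  apply: Zorn_bigcup => G GP totG; split.
    by move=> f A [S GS Sf]; have [+ _] := GP _ GS; apply.
  move=> f g A [S GS Sf] [S' GS' Sg].
  have [SS|SS] := totG _ _ GS GS'.
    by have [_ +] := GP _ GS'; apply => //; apply: SS.
  by have [_ +] := GP _ GS; apply => //; apply: SS.
have [[A FA Asurj]|nsurj] := pselect
    (exists2 A, F A & forall a, A a -> exists2 f, S f & f A = a).
  exists A => // B FB.
  have [a0 Aa0] := neF _ FA.
  have [f0 Sf0 _] := Asurj _ Aa0.
  have /choice[h hP] : forall a, exists f, A a -> S f /\ f A = a.
    move=> a; have [Aa|nAa] := pselect (A a); last by exists f0.
    by have [f Sf fA] := Asurj _ Aa; exists f.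
  have /injfunPex[f] : exists2 f : T -> T, set_fun A B f & set_inj A f.
    exists (fun a => h a B).
      by move=> a Aa; have [Sh _] := hP _ Aa; exact: S1 Sh FB.
    move=> a b /set_mem Aa /set_mem Ab hab.
    have [Sa ha] := hP _ Aa; have [Sb hb] := hP _ Ab.
    by rewrite -ha -hb (S2 _ _ _ Sa Sb FB hab).
  exact: inj_card_le f.
exfalso.
have [t0 _] := neF _ FA0.
have /choice[g gP] : forall A, exists a,
    F A -> A a /\ forall f, S f -> f A <> a.
  move=> A; have [FA|nFA] := pselect (F A); last by exists t0.
  apply: contrapT => /forallNP nA; apply: nsurj; exists A => // a Aa.
  apply: contrapT => na; apply: (nA a) => _; split => // f Sf fA.
  by apply: na; exists f.
apply: (Smax (S `|` [set g])).
  split; first by left.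
  move=> /(_ g (or_intror erefl)) Sg.
  by have [_ /(_ g Sg)] := gP _ FA0.
split.
  by move=> f A [Sf|->] FA; [exact: S1 Sf FA|have [] := gP _ FA].
move=> f f' A [Sf|->] [Sf'|->] FA //.
- exact: S2 Sf Sf' FA.
- by move=> fg; have [_ /(_ f Sf)] := gP _ FA.
- by move=> /esym gf; have [_ /(_ f' Sf')] := gP _ FA.
Qed.

Lemma min_cardP T (F : set (set T)) : F !=set0 ->
  F (min_card F) /\ forall B, F B -> min_card F #<= B.
Proof.
move=> /ex_min_card[A FA Amin].
exact: (@xgetI _ set0 [set C | F C /\ forall B, F B -> C #<= B] A).
Qed.

Lemma card_le_total T U (A : set T) (B : set U) : (A #<= B) || (B #<= A).
Proof.
have cl : (@inl T U @` A) #= A by apply: inj_card_eq => x y _ _ [].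
have cr : (@inr T U @` B) #= B by apply: inj_card_eq => x y _ _ [].
have [] := @ex_min_card _ [set @inl T U @` A; @inr T U @` B].
  by exists (@inl T U @` A); left.
move=> _ [->|->] Amin.
- have /Amin := or_intror erefl : [set @inl T U @` A; @inr T U @` B] (inr @` B).
  by rewrite (card_le_eql cl) (card_le_eqr cr) => ->.
- have /Amin := or_introl erefl : [set @inl T U @` A; @inr T U @` B] (inl @` A).
  by rewrite (card_le_eql cr) (card_le_eqr cl) orbC => ->.
Qed.

Lemma card_lt_powerset (T : Type) : [set: T] #< [set: set T].
Proof.
apply/andP; split.
  have /injfunPex[f] : exists2 f : T -> set T,
      set_fun [set: T] [set: set T] f & set_inj [set: T] f.
    by exists set1 => // x y _ _ xy; have : [set x] x by []; rewrite xy.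
  exact: inj_card_le f.
apply/negP => /card_leP[f].
pose g (B : set T) : T := val (f (SigSub (mem_set (I : [set: set T] B)))).
have ginj : injective g.
  by move=> B C /val_inj BC; have [] := inj (mem_set I) (mem_set I) BC.
pose D := [set x | exists2 B, g B = x & ~ B x].
have DgD : D (g D) -> ~ D (g D) by move=> [B /ginj ->].
have nD : ~ D (g D) by move=> /[dup]/DgD.
by have := nD; apply; exists D.
Qed.

Lemma succ_cardP T (A : set T) : A #< succ_card A /\
  forall (U : Type) (B : set U), A #< B -> succ_card A #<= B.
Proof.
have ApT : A #< [set: set T].
  have /andP[Tp pT] := card_lt_powerset T; apply/andP; split.
    exact: card_le_trans (card_leT A) Tp.
  by apply: contra pT => /card_le_trans; apply; exact: card_leT.
have [ltS Smin] := @min_cardP _ [set B : set (set T) | A #< B]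
  (ex_intro _ [set: set T] ApT).
split=> // U B AB.
have [//|BS] := orP (card_le_total (succ_card A) B).
have [f] := card_leP BS.
pose B' := (fun u => val (f u)) @` [set: set_type B].
have B'E : B' #= B.
  apply: card_eq_trans (card_setT B); apply: inj_card_eq => x y _ _ /val_inj.
  by apply: inj; rewrite inE.
rewrite -(card_le_eqr B'E); apply: Smin => /=.
by rewrite /card_lt (card_le_eqr B'E) (card_le_eql B'E).
Qed.

Lemma densityP (X : topologicalType) : dense (density X) /\
  forall D : set X, dense D -> density X #<= D.
Proof.
apply: (@min_cardP _ [set D : set X | dense D]); exists [set: X].
by move=> O O0 _; rewrite setIT.
Qed.

(* Main.v *)
Require Import Defs.
From HB Require Import structures.
From mathcomp Require Import all_boot.
From mathcomp Require Import boolp classical_sets functions cardinality wochoice.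
From mathcomp Require Import topology.

Set Implicit Arguments.
Unset Strict Implicit.
Unset Printing Implicit Defensive.

Local Open Scope classical_set_scope.
Local Open Scope card_scope.

(* Write kappa = (2^lambda)^+. The Cantor cube 2^(2^lambda) has a dense set of size
   lambda, and more than kappa pairwise disjoint translates of it. Index kappa^+ of
   these translates by a well-order and refine the topology by making the union of
   the layers above any given index open. The result is Urysohn, being finer than
   a Hausdorff regular topology. The closure of a layer contains all the layers
   below it, so any kappa points, lying below some layer, are in the closure of a
   set of size lambda; but a set of at most kappa points lies in a proper closed
   initial union of layers, hence is not dense. *)

(** * Cardinal arithmetic and well-orders *)

Lemma card_le_injP T U (A : set T) (B : set U) (u : U) :
  A #<= B <-> exists2 f : T -> U, set_fun A B f & set_inj A f.
Proof.
split=> [AB|/injfunPex[f]]; last exact: inj_card_le.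
have [f] := card_leP AB.
(* Off [A] the default value [u] only makes the function total. *)
exists (fun x =>
    if pselect (A x) is left Ax then val (f (SigSub (mem_set Ax))) else u).
  by move=> x Ax /=; case: pselect => // Ax'; apply: set_mem; exact: valP.
move=> x y /set_mem Ax /set_mem Ay; case: pselect => // Ax'; case: pselect => // Ay'.
by move=> /val_inj/(inj (mem_set I) (mem_set I))[].
Qed.

Lemma card_le_surj T U (A : set T) (B : set U) (f : U -> T) :
  A `<=` f @` B -> A #<= B.
Proof. by move=> /subset_card_le/card_le_trans; apply; exact: card_image_le. Qed.

(* A pairing graph is the graph of an injection D x D -> D, with D its pairing_dom;
   a Zorn-maximal one extending that of nat x nat -> nat has |D| = |T|. *)
Section square.
Variable T : Type.

Definition pairing_dom (G : set (T * T * T)) : set T :=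
  [set x | exists z, G (x, x, z)].

Definition pairing_graph (G : set (T * T * T)) : Prop :=
  [/\ forall x y z, G (x, y, z) ->
        [/\ pairing_dom G x, pairing_dom G y & pairing_dom G z],
      forall x y, pairing_dom G x -> pairing_dom G y -> exists z, G (x, y, z),
      forall p z z', G (p, z) -> G (p, z') -> z = z' &
      forall p p' z, G (p, z) -> G (p', z) -> p = p'].

(** Each clause of [pairing_graph] assumes at most two triples, and any two triples of the union
    already lie in one [G0]|[G] with [G] in the chain, or in [G0]. Joining [G0] throughout makes a
    Zorn-maximal graph extend it. *)
Lemma pairing_graph_bigcup (G0 : set (T * T * T)) (F : set (set (T * T * T))) :
  pairing_graph G0 -> (forall G, F G -> pairing_graph (G0 `|` G)) ->
  total_on F subset -> pairing_graph (G0 `|` \bigcup_(G in F) G).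
Proof.
move=> G0P FP Ftot; set V := G0 `|` _.
have V2 p q : V p -> V q -> exists H, [/\ pairing_graph H, H `<=` V, H p & H q].
  have sub G : F G -> G0 `|` G `<=` V.
    by move=> FG r [|Gr]; [left|right; exists G].
  move=> [Gp|[G FG Gp]] [Gq|[H FH Hq]].
  - by exists G0; split => // r; left.
  - by exists (G0 `|` H); split; [exact: FP|exact: sub|left|right].
  - by exists (G0 `|` G); split; [exact: FP|exact: sub|right|left].
  - have [GH|HG] := Ftot _ _ FG FH.
    + by exists (G0 `|` H); split; [exact: FP|exact: sub|right; exact: GH|right].
    + by exists (G0 `|` G); split; [exact: FP|exact: sub|right|right; exact: HG].
have subdom H : H `<=` V -> pairing_dom H `<=` pairing_dom V.
  by move=> HV x [z Hz]; exists z; exact: HV.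
split.
- move=> x y z Vxyz; have [H [[H1 _ _ _] HV Hxyz _]] := V2 _ _ Vxyz Vxyz.
  by have [? ? ?] := H1 _ _ _ Hxyz; split; exact: subdom HV _ _.
- move=> x y [z Vz] [z' Vz']; have [H [[_ H2 _ _] HV Hz Hz']] := V2 _ _ Vz Vz'.
  have [||w Hw] := H2 x y; [by exists z|by exists z'|].
  by exists w; exact: HV.
- by move=> p z z' Vz /(V2 _ _ Vz)[H [[_ _ H3 _] _ +]]; exact: H3.
- by move=> p p' z Vz /(V2 _ _ Vz)[H [[_ _ _ H4] _ +]]; exact: H4.
Qed.

(** The square of [D] together with its disjoint copy [h @] D[consists of the old square and three
    further copies of it. These fit side by side into]h @[D]: pair [x] with [y], pair the result
    with the tag [c a b] of its block, and apply [h]. *)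
Lemma pairing_graph_extend (G : set (T * T * T)) (h : T -> T)
    (c : bool -> bool -> T) :
  pairing_graph G -> (forall a b, pairing_dom G (c a b)) ->
  (forall a b a' b', c a b = c a' b' -> (a, b) = (a', b')) ->
  (forall x, pairing_dom G x -> ~ pairing_dom G (h x)) ->
  set_inj (pairing_dom G) h ->
  exists2 G', G `<=` G' & pairing_graph G' /\
    h @` pairing_dom G `<=` pairing_dom G'.
Proof.
set D := pairing_dom G => -[G1 G2 G3 G4] cD cinj hD hinj.
have /choice[p pP] : forall xy, exists z, D xy.1 -> D xy.2 -> G (xy, z).
  move=> [x y]; have [Dx|nDx] := pselect (D x); last by exists x => /nDx.
  have [Dy|nDy] := pselect (D y); last by exists x => _ /nDy.
  by have [z] := G2 x y Dx Dy; exists z.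
have pD x y : D x -> D y -> D (p (x, y)).
  by move=> Dx Dy; have [] := G1 _ _ _ (pP (x, y) Dx Dy).
have pinj x y x' y' : D x -> D y -> D x' -> D y' -> p (x, y) = p (x', y') ->
    x = x' /\ y = y'.
  move=> Dx Dy Dx' Dy' e; have := pP (x, y) Dx Dy; rewrite e.
  by move=> /G4 /(_ (pP (x', y') Dx' Dy'))[].
pose e (a : bool) x := if a then h x else x.
have einj a b x y : D x -> D y -> e a x = e b y -> a = b /\ x = y.
  move=> Dx Dy; case: a b => -[] /= E //.
  - by split => //; apply: hinj => //; exact: mem_set.
  - by have := hD _ Dx; rewrite E.
  - by have := hD _ Dy; rewrite -E.
pose f a b x y := e true (p (c a b, p (x, y))).
have finj a b x y a' b' x' y' : D x -> D y -> D x' -> D y' ->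
    f a b x y = f a' b' x' y' -> [/\ a = a', b = b', x = x' & y = y'].
  move=> Dx Dy Dx' Dy' /einj E.
  have [||_ {}E] := E; [by apply: (pD) => //; exact: pD..|].
  have [||||/cinj[-> ->] {}E] := pinj _ _ _ _ _ _ _ _ E.
  - by [].
  - exact: pD.
  - by [].
  - exact: pD.
  by have [||||-> ->] := pinj _ _ _ _ _ _ _ _ E.
pose N := [set q | exists a b x y, [/\ a || b, D x, D y &
  q = (e a x, e b y, f a b x y)]].
have domG' : pairing_dom (G `|` N) = D `|` h @` D.
  apply/seteqP; split=> x.
    move=> [z [Gz|[a [b [x' [y' [ab Dx Dy [-> _ _]]]]]]]].
      by left; exists z.
    by case: a {ab} => /=; [right; exists x'|left].
  move=> [[z Gz]|[y Dy <-]]; first by exists z; left.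
  by exists (f true true y y); right; exists true, true, y, y.
have De a x : D x -> (D `|` h @` D) (e a x).
  by move=> Dx; case: a; [right; exists x|left].
exists (G `|` N); first by left.
split; last by rewrite domG'; right.
(* An old triple and a new one differ both in their pair and in their value; this settles the mixed
   cases of functionality and injectivity below. *)
have GN x y z a b x' y' : G (x, y, z) -> a || b -> D x' -> D y' ->
    (x, y) <> (e a x', e b y') /\ z <> f a b x' y'.
  move=> /G1[Dx Dy Dz] ab Dx' Dy'; split.
    move=> [xE yE]; case/orP: ab xE yE => -> /=.
      by move=> xE; have := hD _ Dx'; rewrite -xE.
    by move=> _ yE; have := hD _ Dy'; rewrite -yE.
  move=> zE; have := hD _ (pD _ _ (cD a b) (pD _ _ Dx' Dy')).
  by apply; move: Dz; rewrite zE.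
rewrite /pairing_graph domG'; split.
- move=> x y z [/G1[? ? ?]|]; first by split; left.
  move=> [a [b [x' [y' [ab Dx Dy [-> -> ->]]]]]]; split; [exact: De..|].
  by apply: De; apply: (pD) => //; exact: pD.
- have eP x : (D `|` h @` D) x -> exists a x', D x' /\ x = e a x'.
    by move=> [Dx|[y Dy <-]]; [exists false, x|exists true, y].
  move=> x y /eP[a [x' [Dx ->]]] /eP[b [y' [Dy ->]]].
  have [ab|] := boolP (a || b).
    by exists (f a b x' y'); right; exists a, b, x', y'.
  case: a b => -[] // _; exists (p (x', y')); left; exact: (pP (x', y')).
- move=> [x y] z z' [Gz|Nz] [Gz'|Nz'].
  + exact: G3 Gz Gz'.
  + case: Nz' => a [b [x' [y' [ab Dx Dy [xE yE _]]]]].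
    by have [] := GN _ _ _ _ _ _ _ Gz ab Dx Dy; rewrite xE yE.
  + case: Nz => a [b [x' [y' [ab Dx Dy [xE yE _]]]]].
    by have [] := GN _ _ _ _ _ _ _ Gz' ab Dx Dy; rewrite xE yE.
  + case: Nz Nz' => a [b [x' [y' [ab Dx Dy [-> -> ->]]]]].
    move=> [a' [b' [x'' [y'' [ab' Dx' Dy' [E1 E2 ->]]]]]].
    have [//|//|-> ->] := einj _ _ _ _ _ _ E1.
    by have [//|//|-> ->] := einj _ _ _ _ _ _ E2.
- move=> [x1 y1] [x2 y2] z [Gz|Nz] [Gz'|Nz'].
  + exact: G4 Gz Gz'.
  + case: Nz' => a [b [x' [y' [ab Dx Dy [_ _ zE]]]]].
    by have [] := GN _ _ _ _ _ _ _ Gz ab Dx Dy.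
  + case: Nz => a [b [x' [y' [ab Dx Dy [_ _ zE]]]]].
    by have [] := GN _ _ _ _ _ _ _ Gz' ab Dx Dy.
  + case: Nz Nz' => a [b [x' [y' [ab Dx Dy [-> -> ->]]]]].
    move=> [a' [b' [x'' [y'' [ab' Dx' Dy' [-> -> E]]]]]].
    by have [//|//|//|//|-> -> -> ->] := finj _ _ _ _ _ _ _ _ _ _ _ _ E.
Qed.

Lemma pairing_graph_nat (u : nat -> T) : injective u ->
  pairing_graph [set (u n.1, u n.2, u (pickle n)) | n in [set: nat * nat]].
Proof.
move=> uinj; set G := [set _ | _ in _].
have domG : pairing_dom G = range u.
  apply/seteqP; split=> [x [z [n _ [<- _ _]]]|_ [n _ <-]]; first by exists n.1.
  by exists (u (pickle (n, n))), (n, n).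
rewrite /pairing_graph domG; split.
- by move=> x y z [n _ [<- <- <-]]; split; eexists.
- by move=> _ _ [n _ <-] [m _ <-]; exists (u (pickle (n, m))), (n, m).
- by move=> p z z' [n _ [<- <-]] [[m1 m2] _ [/uinj -> /uinj -> <-]]; case: n.
- move=> p p' z [n _ [<- <-]] [m _ [<- /uinj/(pcan_inj pickleK) ->]] //.
Qed.

End square.

Lemma card_le_square T : infinite_set [set: T] -> [set: T * T] #<= [set: T].
Proof.
move=> Tinf.
have t0 : T by have /infinite_setN0/cid[] := Tinf.
have /infiniteP/(card_le_injP _ _ t0)[u _ uinj'] := Tinf.
have uinj : injective u by move=> n m; apply: uinj'; exact: in_setT.
have G0P := pairing_graph_nat uinj; set G0 := [set _ | _ in _] in G0P.
have [F FP Ftot|M [MP Mmax]] :=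
  @Zorn_bigcup _ [set G | pairing_graph (G0 `|` G)].
  exact: pairing_graph_bigcup.
pose G := G0 `|` M; pose D := pairing_dom G.
have uD n : D (u n) by exists (u (pickle (n, n))); left; exists (n, n).
have [G1 G2 G3 G4] : pairing_graph G by [].
have DD : D `*` D #<= D.
  have /choice[p pP] : forall xy, exists z, D xy.1 -> D xy.2 -> G (xy, z).
    move=> [x y]; have [Dx|nDx] := pselect (D x); last by exists x => /nDx.
    have [Dy|nDy] := pselect (D y); last by exists x => _ /nDy.
    by have [z] := G2 x y Dx Dy; exists z.
  apply/(card_le_injP _ _ t0); exists p.
    by move=> [x y] [/= Dx Dy]; have [] := G1 _ _ _ (pP (x, y) Dx Dy).
  move=> [x y] [x' y'] /set_mem[/= Dx Dy] /set_mem[/= Dx' Dy'] E.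
  have := pP (x, y) Dx Dy; rewrite E => /G4; apply.
  exact: (pP (x', y')).
(* If [T] injects into [D], its square does too. Otherwise the complement of [D] cannot inject into
   [D], since then |T| <= 2|D| <= |D|^2 <= |D|; so [D] injects into its complement and the graph
   extends, against maximality. *)
have [TD|nTD] := boolP ([set: T] #<= D).
  apply: card_le_trans (card_leT D); apply: card_le_trans DD.
  have /(card_le_injP _ _ t0)[g gD ginj] := TD.
  apply/(card_le_injP _ _ (t0, t0)); exists (fun xy => (g xy.1, g xy.2)).
    by move=> xy _; split; exact: gD.
  move=> [x y] [x' y'] _ _ /= [].
  by move=> /ginj-> //; rewrite ?in_setT // => /ginj -> //; rewrite in_setT.
have [nDD|DnD] := orP (card_le_total (~` D) D).
  exfalso; move/negP: nTD; apply; apply: card_le_trans DD.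
  have /(card_le_injP _ _ t0)[g gD ginj] := nDD.
  apply/(card_le_injP _ _ (t0, t0)).
  exists (fun x => if pselect (D x) is left _ then (u 0, x) else (u 1, g x)).
    by move=> x _; case: pselect => Dx; split => //=; exact: gD.
  move=> x y _ _; case: pselect => Dx; case: pselect => Dy [].
  - by [].
  - by move=> /uinj.
  - by move=> /uinj.
  - by apply: ginj; exact: mem_set.
have /(card_le_injP _ _ t0)[h hD hinj] := DnD.
(* The four block tags are [u 0], ..., [u 3], which lie in [D] because [G] contains [G0]. *)
have [|||||G' GG' [G'P hG']] :=
  @pairing_graph_extend _ G h (fun a b => u (2 * a + b)).
- by [].
- by move=> a b; exact: uD.
- by move=> a b a' b' /uinj/eqP; case: a b a' b' => -[] [] [].
- by move=> x /hD.
- by [].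
exfalso; apply: (Mmax G').
  split; first by move=> q Mq; apply: GG'; right.
  move=> G'M; have [|z] := hG' (h (u 0)); first by exists (u 0) => //; exact: uD.
  by move=> /G'M Mz; apply: (hD _ (uD 0)); exists z; right.
suff -> : [set G | pairing_graph (G0 `|` G)] G' = pairing_graph G' by [].
congr pairing_graph; apply/seteqP; split=> [q [G0q|//]|q]; last by right.
by apply: GG'; left.
Qed.

Lemma card_set1_le T U (x : T) (A : set U) : A !=set0 -> [set x] #<= A.
Proof.
move=> [u Au]; apply/(card_le_injP _ _ u); exists (fun=> u) => //.
by move=> y z /set_mem-> /set_mem->.
Qed.

Lemma infinite_card_le T U (A : set T) (B : set U) :
  A #<= B -> infinite_set A -> infinite_set B.
Proof. by move=> AB; apply: contra_not; exact: card_le_finite. Qed.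

Lemma card_le_setX T U V (A : set T) (B : set U) (K : set V) : infinite_set K ->
  A #<= K -> B #<= K -> A `*` B #<= K.
Proof.
move=> Kinf AK BK.
have k : K by have /infinite_setN0/cid[k Kk] := Kinf; exists k; exact: mem_set.
have KT : infinite_set [set: K].
  by apply: infinite_card_le Kinf; rewrite (card_le_eqr (card_setT K)).
rewrite -(card_le_eqr (card_setT K)); apply: card_le_trans (card_le_square KT).
have toT T' (C : set T') : C #<= K -> C #<= [set: K].
  by rewrite (card_le_eqr (card_setT K)).
have /(card_le_injP _ _ k)[f _ finj] := toT _ _ AK.
have /(card_le_injP _ _ k)[g _ ginj] := toT _ _ BK.
apply/(card_le_injP _ _ (k, k)); exists (fun xy => (f xy.1, g xy.2)) => //.
move=> [x y] [x' y'] /set_mem[/= Ax By] /set_mem[/= Ax' By'] [fE gE].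
rewrite (finj _ _ (mem_set Ax) (mem_set Ax') fE).
by rewrite (ginj _ _ (mem_set By) (mem_set By') gE).
Qed.

(** Simultaneously chosen maps [g i], each with [F i] inside the image of [K], make the union an
    image of part of [A]*[K], whose size is at most that of [K]. *)
Lemma card_le_bigcup I T V (A : set I) (F : I -> set T) (K : set V) :
  infinite_set K -> A #<= K -> (forall i, A i -> F i #<= K) ->
  \bigcup_(i in A) F i #<= K.
Proof.
move=> Kinf AK FK.
have [[t0 _]|/set0P/negP/negPn/eqP->] := pselect ((\bigcup_(i in A) F i) !=set0);
  last exact: card_ge0.
have /infinite_setN0[k Kk] := Kinf.
have /choice[g gP] : forall i, exists g : V -> T, A i -> F i `<=` g @` K.
  move=> i; have [Ai|nAi] := pselect (A i); last by exists (fun=> t0).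
  have /(card_le_injP _ _ k)[f fK finj] := FK i Ai.
  have /choice[g gP] : forall v, exists t, forall t', F i t' -> f t' = v -> t' = t.
    move=> v; have [[t Fit ft]|nt] := pselect (exists2 t, F i t & f t = v).
      exists t => t' Fit' ft'; apply: finj; rewrite ?inE// ft ft' //.
    by exists t0 => t' Fit' ft'; exfalso; apply: nt; exists t'.
  by exists g => _ t Ft; exists (f t); [exact: fK|rewrite -(gP (f t) t)].
apply: card_le_trans (card_le_setX Kinf AK (card_lexx K)).
apply: (@card_le_surj _ _ _ _ (fun iv => g iv.1 iv.2)) => t [i Ai /(gP i Ai)[v Kv <-]].
by exists (i, v).
Qed.

Lemma card_le_setU T V (A B : set T) (K : set V) :
  infinite_set K -> A #<= K -> B #<= K -> A `|` B #<= K.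
Proof.
move=> Kinf AK BK.
have -> : A `|` B = \bigcup_(b in [set: bool]) (if b then A else B).
  by apply/seteqP; split=> [t [At|Bt]|t [[] _ At]];
     [exists true|exists false|left|right].
apply: card_le_bigcup => //; last by case.
move/infiniteP: Kinf => /(card_le_trans _); apply.
by apply/(card_le_injP _ _ 0); exists nat_of_bool => // -[] [].
Qed.

Lemma card_le_seq T V (K : set V) :
  infinite_set K -> [set: T] #<= K -> [set: seq T] #<= K.
Proof.
move=> Kinf TK.
have -> : [set: seq T] = \bigcup_(n in [set: nat]) [set s | size s = n].
  by apply/seteqP; split=> // s _; exists (size s).
apply: card_le_bigcup => //; first exact/infiniteP.
elim=> [_|n IHn _].
  apply: card_le_trans (card_set1_le [::] (infinite_setN0 Kinf)).
  by apply: subset_card_le => -[].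
apply: card_le_trans (card_le_setX Kinf TK (IHn I)).
apply: (@card_le_surj _ _ _ _ (fun xs => xs.1 :: xs.2)) => -[//|x s] /= [sn].
by exists (x, s).
Qed.

(* W is the initial segment of a well-order of P formed by the elements with at most
   |K| predecessors: a cofinal subset of size at most |K| would give |W| <= |K|. *)
Lemma ex_strictly_directed P V (K : set V) : infinite_set K -> K #< [set: P] ->
  exists (W : set P) (le : P -> P -> Prop),
    [/\ forall x, le x x, forall x y z, le x y -> le y z -> le x z &
        forall A : set P, A `<=` W -> A #<= K ->
          exists2 i, W i & forall a, A a -> le a i /\ ~ le i a].
Proof.
move=> Kinf /andP[_ /negP nPK].
have [le wo] := well_ordering_principle {classic P}.
have le_wo : wo_chain le predT by move=> A _; exact: wo.
have refl x : le x x by exact: (wo_chain_reflexive le_wo).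
have anti x y : le x y -> le y x -> x = y.
  by move=> xy yx; apply: (wo_chain_antisymmetric le_wo) => //; rewrite xy yx.
have tot x y : le x y \/ le y x.
  by apply/orP; exact: (wo_chainW le_wo).
have minP (A : set P) : A !=set0 -> exists2 m, A m & forall a, A a -> le m a.
  move=> [a Aa]; have [|m [[Am mA] _]] := wo [pred x | `[< A x >]].
    by exists a; apply/asboolP.
  exists m; first exact/asboolP.
  by move=> b Ab; apply: mA; apply/asboolP.
have trans x y z : le x y -> le y z -> le x z.
  move=> xy yz; have [|m Am mA] := minP [set x; y; z]; first by exists x; left; left.
  case: Am => [[mx|my]|mz].
  - by rewrite -mx; apply: mA; right.
  - by have <- : y = x by apply: anti => //; rewrite -my; apply: mA; left; left.
  - have zy : z = y by apply: anti yz; rewrite -mz; apply: mA; left; right.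
    by rewrite zy.
pose W := [set x | [set y | le y x /\ y <> x] #<= K].
(* If |W| <= |K|, some point lies outside [W] because |P| > |K|. All predecessors of the least such
   point are in [W], so there are at most |K| of them, which puts the point in [W]. *)
have nWK : ~ (W #<= K).
  move=> WK; have [[x nWx]|nx] := pselect ((~` W) !=set0); last first.
    apply: nPK; apply: card_le_trans WK; apply: subset_card_le => x _.
    by apply: contrapT => nWx; apply: nx; exists x.
  have [m nWm mmin] := minP _ (ex_intro _ x nWx); apply: nWm.
  apply: card_le_trans WK; apply: subset_card_le => y [ym ynm].
  by apply: contrapT => /mmin my; apply: ynm; exact: anti.
exists W, le; split=> // A AW AK.
apply: contrapT => nA; apply: nWK.
have -> : W = W `&` \bigcup_(a in A) ([set y | le y a /\ y <> a] `|` [set a]).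
  apply/esym/setIidPl => i Wi; apply: contrapT => ni; apply: nA; exists i => // a Aa.
  have nia : ~ le i a.
    move=> ia; apply: ni; exists a => //.
    by have [->|ia'] := pselect (i = a); [right|left].
  by split => //; have [] := tot a i.
apply: card_le_trans (subset_card_le (@subIsetr _ _ _)) _.
apply: card_le_bigcup => // a /AW Wa; apply: card_le_setU => //.
exact: card_set1_le (infinite_setN0 Kinf).
Qed.

(** * Topologies generated by coordinates and a preorder *)

(** Basic neighbourhoods of [x]: those of the topology induced by [v] from the Cantor cube, cut down
    to the points above [x], so that up-sets become open. *)
Definition cylinder X C (le : X -> X -> Prop) (v : X -> C -> bool)
    (x : X) (l : seq C) : set X :=
  [set y | le x y /\ all (fun c => v y c == v x c) l].

(** An alias of [X] that records [le] and [v], so that the type determines its topology. *)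
Definition cylinder_space X C (le : X -> X -> Prop) (v : X -> C -> bool) : Type := X.

Section cylinder_space.
Context X C (le : X -> X -> Prop) (v : X -> C -> bool).
Local Notation cyl := (cylinder le v).
Local Notation Y := (cylinder_space le v).

HB.instance Definition _ := gen_eqMixin Y.
HB.instance Definition _ := gen_choiceMixin Y.

Let op (U : set Y) := forall x, U x -> exists l, cyl x l `<=` U.

Let opT : op setT. Proof. by move=> x _; exists [::]. Qed.

Let opI : setI_closed op.
Proof.
move=> U V Uop Vop x [/Uop[l lU] /Vop[m mV]]; exists (l ++ m) => y [xy].
by rewrite all_cat => /andP[yl ym]; split; [exact: lU|exact: mV].
Qed.

Let op_bigU (I : Type) (f : I -> set Y) :
  (forall i, op (f i)) -> op (\bigcup_i f i).
Proof.
by move=> fop x [i _ /fop[l lf]]; exists l => y /lf fy; exists i.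
Qed.

HB.instance Definition _ := isOpenTopological.Build Y opT opI op_bigU.

Hypothesis le_refl : forall x, le x x.
Hypothesis le_trans : forall x y z, le x y -> le y z -> le x z.

Lemma cylinder_center x l : cyl x l x.
Proof. by split=> //; elim: l => //= c l ->; rewrite eqxx. Qed.

Lemma cylinder_open x l : open (cyl x l : set Y).
Proof.
move=> y [xy yl]; exists l => z [yz zl]; split; first exact: le_trans yz.
by elim: l yl zl => //= c l IHl /andP[/eqP<- /IHl yl] /andP[-> /yl].
Qed.

Lemma nbhs_cylinder (x : Y) U : nbhs x U <-> exists l, cyl x l `<=` U.
Proof.
rewrite nbhsE; split=> [[V [Vop /Vop[l lV]] VU]|[l lU]].
  by exists l; apply: subset_trans VU.
exists (cyl x l) => //; split; [exact: cylinder_open|exact: cylinder_center].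
Qed.

Lemma closure_cylinderP (A : set Y) x :
  closure A x <-> forall l, A `&` cyl x l !=set0.
Proof.
split=> [Ax l|Ax U /nbhs_cylinder[l lU]].
  by apply: Ax; apply/nbhs_cylinder; exists l.
by have [y [Ay /lU Uy]] := Ax l; exists y.
Qed.

(** Each coordinate is locally constant, so the value at [c] that a one-coordinate cylinder
    prescribes persists on its closure. A coordinate separating two points thus yields disjoint
    closures. *)
Lemma urysohn_cylinder_space :
  (forall x y, x <> y -> exists c, v x c != v y c) -> urysohn_space Y.
Proof.
move=> sep x y /eqP/sep[c vc]; exists (cyl x [:: c]), (cyl y [:: c]).
have closure_coord z w : closure (cyl z [:: c] : set Y) w -> v w c = v z c.
  move=> /closure_cylinderP/(_ [:: c])[u [[_ /= +] [_ /=]]].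
  by rewrite !andbT => /eqP-> /eqP->.
split; [by apply/nbhs_cylinder; exists [:: c]..|].
apply/eqP/negPn/negP => /set0P[w [/closure_coord wx /closure_coord wy]].
by move/eqP: vc; rewrite -wx -wy.
Qed.

End cylinder_space.

(** * A small dense set in the Cantor cube, and the layered space *)

Section small_dense.
Variable L : Type.

(* Hewitt-Marczewski-Pondiczery: finitely many sets c.1 are told apart by their
   traces on a finite list d.1 of points. *)
Definition trace_fun (d : seq L * seq (seq bool * nat)) (c : set L * nat) : bool :=
  ([seq `[< c.1 a >] | a <- d.1], c.2) \in d.2.

Lemma card_trace_fun : infinite_set [set: L] -> range trace_fun #<= [set: L].
Proof.
move=> Linf; apply: card_le_trans (card_image_le _ _) _.
rewrite -setXTT; apply: card_le_setX => //; first exact: card_le_seq.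
have /infiniteP := Linf; apply: card_le_trans.
exact/countableP.
Qed.

Lemma trace_fun_eventually0 t : range trace_fun t ->
  exists N, forall A n, N <= n -> t (A, n) = false.
Proof.
move=> [[F phi] _ <-]; exists (\max_(p <- phi) p.2).+1 => A n nN.
apply/negP => phin; move: nN; rewrite leqNgt => /negP; apply.
by rewrite ltnS; exact: (@leq_bigmax_seq _ phi xpredT snd _ phin).
Qed.

(** Finitely many points of [L] separate the sets occurring in [l], so members of [l] are determined
    by their traces. Listing the traces of those members where [w] is true gives a function agreeing
    with [w] on [l]. *)
Lemma trace_fun_dense (w : set L * nat -> bool) (l : seq (set L * nat)) : L ->
  exists2 t, range trace_fun t & all (fun c => t c == w c) l.
Proof.
(* [d] picks a point at which two distinct sets differ; for equal sets any point will do. *)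
move=> a0; have /choice[d dP] : forall AB : set L * set L, exists a,
    `[< AB.1 a >] = `[< AB.2 a >] -> AB.1 = AB.2.
  move=> [A B] /=; have [->|AB] := pselect (A = B); first by exists a0.
  apply: contrapT => /forallNP nd; apply: AB; apply/funext => a; apply/propext.
  have : `[< A a >] = `[< B a >] by apply: contrapT => ab; apply: (nd a) => /ab.
  by move=> ab; split=> /asboolP; [rewrite ab|rewrite -ab] => /asboolP.
pose F := [seq d p | p <- [seq (c.1, c'.1) | c <- l, c' <- l]].
pose code (c : set L * nat) := ([seq `[< c.1 a >] | a <- F], c.2).
have code_inj c c' : c \in l -> c' \in l -> code c = code c' -> c = c'.
  move: c c' => [A n] [B m] cl cl' [E ->]; congr (_, _).
  apply: (dP (A, B)); move: E; rewrite /F -!map_comp => /eq_in_map; apply.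
  by apply/allpairsP; exists ((A, n), (B, m)).
exists (trace_fun (F, [seq code c | c <- l & w c])); first by eexists.
apply/allP => c cl; apply/eqP; apply/mapP/idP => [[c']|wc].
  by rewrite mem_filter => /andP[wc' cl'] /code_inj->.
by exists c => //; rewrite mem_filter wc.
Qed.

End small_dense.

(* Points are pairs (i, t) with i the layer and t in the dense set; (i, t) sits at
   the translate of t by i modulo 2. Since t vanishes at (A, n) for n large, the
   coordinates (A, n) recover i, so that the translates are pairwise disjoint. *)
Lemma ex_urysohn_dominating L V (W : set (set (set L)))
    (le : set (set L) -> set (set L) -> Prop) (K : set V) :
  infinite_set [set: L] -> [set: L] #< K ->
  (forall i, le i i) -> (forall i j k, le i j -> le j k -> le i k) ->
  (forall A, A `<=` W -> A #<= K ->
    exists2 i, W i & forall a, A a -> le a i /\ ~ le i a) ->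
  exists X : topologicalType,
    [/\ urysohn_space X, dominating_pair K [set: L] X & [set: L] #< density X].
Proof.
move=> Linf LK le_refl le_trans bounded.
have [a0 _] := infinite_setN0 Linf.
pose S := W `*` range (@trace_fun L).
have SP i t : W i -> range (@trace_fun L) t -> (i, t) \in S.
  by move=> Wi Tt; exact/mem_set.
pose lev (x : S) := (val x).1.
have Wlev x : W (lev x) by have /set_mem[] := valP x.
have Tx (x : S) : range (@trace_fun L) (val x).2 by have /set_mem[] := valP x.
pose leS x y := le (lev x) (lev y).
pose v (x : S) (c : set L * nat) := `[< lev x c.1 >] (+) (val x).2 c.
pose X : topologicalType := cylinder_space leS v.
have leS_refl x : leS x x by exact: le_refl.
have leS_trans x y z : leS x y -> leS y z -> leS x z by exact: le_trans.
have boundedX (A : set X) : A #<= K ->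
    exists2 i, W i & forall a : S, A a -> le (lev a) i /\ ~ le i (lev a).
  move=> AK; have [||i Wi iP] := bounded (lev @` A).
  - by move=> _ [a _ <-]; exact: Wlev.
  - exact: card_le_trans (card_image_le _ _) AK.
  - by exists i => // a Aa; apply: iP; exists a.
(* Density of the untranslated set is applied to the target shifted by [i]; the second shift by [i],
   built into [v], cancels the first. *)
have layer_dense i (Wi : W i) (x : S) l : le (lev x) i ->
    exists2 y : S, lev y = i & cylinder leS v x l y.
  move=> xi; have [t Tt tl] := trace_fun_dense (fun c => `[< i c.1 >] (+) v x c) l a0.
  exists (SigSub (SP _ _ Wi Tt)) => //; split=> //.
  apply: sub_all tl => c /eqP tc; rewrite {1}/v /= tc.
  by rewrite /lev /= addKb.
exists X; split.
- apply: urysohn_cylinder_space => // x y xy.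
  have [N tN] := trace_fun_eventually0 (Tx x).
  have [N' tN'] := trace_fun_eventually0 (Tx y).
  have [lxy|/eqP lxy] := eqVneq (lev x) (lev y).
    (* Within a layer the common shift cancels, so a coordinate where the second components differ
       separates the points. *)
    have [c cxy] : exists c, (val x).2 c != (val y).2 c.
      apply: contrapT => /forallNP nc; apply: xy; apply: val_inj.
      rewrite [LHS]surjective_pairing [RHS]surjective_pairing; congr (_, _) => //.
      by apply/funext => c; apply/eqP/negPn/negP/nc.
    by exists c; rewrite /v lxy; apply: contra cxy => /eqP/addbI/eqP.
  have [A Axy] : exists A, `[< lev x A >] != `[< lev y A >].
    apply: contrapT => /forallNP nA; apply: lxy; apply/funext => A; apply/propext.
    have /negP/negPn/eqP E := nA A.
    by split=> /asboolP; [rewrite E|rewrite -E] => /asboolP.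
  (* Past both bounds the second components vanish, and [v] reads off membership of [A] in the two
     layers. *)
  exists (A, maxn N N'); rewrite /v tN ?leq_maxl// tN' ?leq_maxr//.
  by rewrite !addbF.
- split=> // A /boundedX[i Wi iP].
  exists [set x : S | lev x = i]; split.
    apply: card_le_trans (card_trace_fun Linf).
    apply/(card_le_injP _ _ (fun=> true)); exists (fun x : S => (val x).2) => [x _|].
      exact: Tx.
    move=> x y /set_mem xi /set_mem yi xy; apply: val_inj.
    rewrite [LHS]surjective_pairing [RHS]surjective_pairing xy; congr (_, _).
    by rewrite -[LHS]/(lev x) -[RHS]/(lev y) xi yi.
  move=> x /iP[xi _]; apply/closure_cylinderP => // l.
  by have [y yi xy] := layer_dense i Wi x l xi; exists y.
have [Ddense _] := densityP X.
have nDK : ~ (density X #<= K).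
  move=> /boundedX[i Wi iP].
  have [t Tt _] := trace_fun_dense (fun=> true) [::] a0.
  pose x : S := SigSub (SP _ _ Wi Tt).
  (* The empty list of coordinates gives the whole up-set of [x], a nonempty open set that misses
     [density X], all of whose points lie strictly below layer [i]. *)
  have xop : open (cylinder leS v x [::] : set X) by exact: (@cylinder_open _ _ leS v).
  have [|z [xz Dz]] := Ddense _ _ xop.
    by exists x; exact: cylinder_center.
  by have [_] := iP z Dz; apply; case: xz.
apply/andP; split; last first.
  by apply/negP => DL; apply: nDK; apply: card_le_trans DL _; case/andP: LK.
have [//|DL] := orP (card_le_total [set: L] (density X)).
by exfalso; apply: nDK; apply: card_le_trans DL _; case/andP: LK.
Qed.

Theorem mainTheorem6 (L : Type) (Linf : infinite_set [set: L])
    (hL : succ_card [set: set L] #< [set: set (set L)]) :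
  exists X : topologicalType,
    [/\ urysohn_space X,
        dominating_pair (succ_card [set: set L]) [set: L] X
      & [set: L] #< density X].
Proof.
have [/andP[PS nSP] _] := succ_cardP [set: set L].
have /andP[LP nPL] := card_lt_powerset L.
have LS := card_le_trans LP PS.
(* By [hL] the layers can be indexed by elements of [set (set L)]; these are themselves 0-1 vectors
   over [set L], ready to serve as translations. *)
have [W [le [le_refl le_trans bounded]]] :=
  ex_strictly_directed (infinite_card_le LS Linf) hL.
apply: (ex_urysohn_dominating Linf) le_refl le_trans bounded.
apply/andP; split=> //.
by apply: contra nSP => /card_le_trans; apply.
Qed.
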